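(* Any Hippasus number is a Fibonacci number.
   Context: The Fibonacci numbers are the terms of the sequence $F_0=1$, $F_1=1$, $F_n=F_{n-2}+F_{n-1}$ for $n\ge 2$. An integer $\beta\ge 1$ is called a Hippasus number if there exists an integer $\alpha\ge\beta$ such that $\beta(\beta+\alpha)-\alpha^2=(-1)^{\gamma}$ for some non-negative integer $\gamma$; any such $\alpha$ is called a Hippasus successor of $\beta$. *)

(* Defs.v *)
From Stdlib Require Import ZArith.
(* [Zgcd_alt.fibonacci] satisfies fibonacci 0 = fibonacci 1 = 1, so 0 is not
   a Fibonacci number. *)
From Stdlib Require Import Zgcd_alt.

Open Scope Z_scope.

Definition is_fibonacci (b : Z) : Prop := exists n : nat, b = fibonacci n.

Definition hippasus_successor (b a : Z) : Prop :=
  a >= b /\ exists g : Z, 0 <= g /\ b * (b + a) - a ^ 2 = (-1) ^ g.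

Definition hippasus (b : Z) : Prop :=
  b >= 1 /\ exists a : Z, hippasus_successor b a.

(* Main.v *)
Require Import Defs.
From Stdlib Require Import ZArith.
From Stdlib Require Import Zgcd_alt Lia.

(** If [b < a], the pair [(b, a)] descends to [(a - b, b)]: the form
    [b (b + a) - a^2] only changes sign, and the values [1] and [-1] force
    [a - b <= b].  The descent reverses the Fibonacci recurrence and ends at
    [(1, 1)]. *)

Open Scope Z_scope.

Lemma hippasus_form_descent (b a : Z) :
  1 <= b -> Z.abs (b * (b + a) - a ^ 2) = 1 ->
  a - b <= b /\ Z.abs ((a - b) * (a - b + b) - b ^ 2) = 1.
Proof.
  intros hb h.
  split.
  (* If [a > 2 * b], then [a * (a - b) > 2 * b ^ 2], so the form is less than [- b ^ 2 <= -1]. *)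
  - destruct (Z.le_gt_cases (a - b) b) as [hle | hgt]; [exact hle | nia].
  - replace ((a - b) * (a - b + b) - b ^ 2) with (- (b * (b + a) - a ^ 2)) by ring.
    now rewrite Z.abs_opp.
Qed.

(** Strong induction on the larger entry, which drops from [a] to [b]. Keeping both entries as
    consecutive terms lets the recurrence recover [a] from [a - b] and [b]. *)
Lemma hippasus_pair_fibonacci (a : Z) :
  forall b : Z, 1 <= b <= a -> Z.abs (b * (b + a) - a ^ 2) = 1 ->
  exists n : nat, b = fibonacci n /\ a = fibonacci (S n).
Proof.
  destruct (Z.le_gt_cases 0 a) as [ha | ha]; [| intros; lia].
  revert a ha.
  apply (Z_lt_induction (fun a => forall b : Z, 1 <= b <= a ->
    Z.abs (b * (b + a) - a ^ 2) = 1 ->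
    exists n : nat, b = fibonacci n /\ a = fibonacci (S n))).
  intros a IH b [hb hba] h.
  destruct (Z.eq_dec a b) as [-> | hne].
  (* On the diagonal the form is [b ^ 2], so [b = 1]. *)
  - exists 0%nat; simpl; nia.
  - destruct (hippasus_form_descent b a hb h) as [hle h'].
    destruct (IH b ltac:(lia) (a - b) ltac:(lia) h') as [n [hn hSn]].
    exists (S n).
    split; [exact hSn |].
    change (a = fibonacci (S n) + fibonacci n); lia.
Qed.

Theorem proposition0p17 (b : Z) (hb : hippasus b) : is_fibonacci b.
Proof.
  destruct hb as [hb [a [hab [g [hg h]]]]].
  assert (habs : Z.abs (b * (b + a) - a ^ 2) = 1).
  (* The absolute value removes the dependence on the parity of [g]. *)
  { rewrite h, Z.abs_pow; now apply Z.pow_1_l. }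
  destruct (hippasus_pair_fibonacci a b ltac:(lia) habs) as [n [hn _]].
  now exists n.
Qed.
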